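(* Let $\Sigma$ be a signed graph. Then $\mathsf E(\Sigma,x,y)=\mathsf O(\Sigma,x,y)$ if and only if $\Sigma$ is balanced.
   Context: A signed graph $\Sigma=(\Gamma,\sigma)$ is a finite simple graph $\Gamma$ with a signature $\sigma:E(\Gamma)\to\{\pm1\}$; it is balanced if every cycle has an even number of negative edges. For a finite $C\subseteq\mathbb Z$, a proper $C$-colouring of $\Sigma$ is a map $\kappa:V(\Gamma)\to C$ with $\kappa(v)\ne\sigma(\{v,w\})\kappa(w)$ for every edge $\{v,w\}$. For integers $\lambda\ge\mu\ge0$, a finite $C\subseteq\mathbb Z$ is a $(\lambda,\mu)$-colour set if there are disjoint sets $P,U$ of nonzero integers with $-P=P$, $|U|=\mu$, $(-U)\cap U=\varnothing$, and either $\lambda-\mu$ even, $|P|=\lambda-\mu$, $C=P\cup U$, or $\lambda-\mu$ odd, $|P|=\lambda-\mu-1$, $C=P\cup U\cup\{0\}$. $f(\Sigma,\lambda,\mu)$ is the number of proper $C$-colourings for any $(\lambda,\mu)$-colour set $C$ (independent of $C$). $\mathsf E(\Sigma,x,y),\mathsf O(\Sigma,x,y)\in\mathbb Z[x,y]$ are the unique polynomials with $f(\Sigma,\lambda,\mu)=\mathsf E(\Sigma,\lambda,\mu)$ for all integers $\lambda\ge\mu\ge0$ with $\lambda-\mu$ even and $f(\Sigma,\lambda,\mu)=\mathsf O(\Sigma,\lambda,\mu)$ whenever $\lambda-\mu$ is odd. *)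

(* Defs.v *)
From Stdlib Require Import ClassicalEpsilon.
From HB Require Import structures.
From mathcomp Require Import all_boot all_order all_algebra.
From mathcomp Require Import finmap.
From mathcomp Require Import mpoly.

Set Implicit Arguments.
Unset Strict Implicit.
Unset Printing Implicit Defensive.

Import GRing.Theory.
Local Open Scope ring_scope.

(* The sign of the edge {v, w} is [sgn [set v; w]]; the values of [sgn] on
   sets that are not edges are never used. *)
Record signed_graph := SignedGraph {
  vertex : finType;
  adj : rel vertex;
  adj_sym : ssrbool.symmetric adj;
  adj_irr : irreflexive adj;
  sgn : {set vertex} -> int;
  sgnP : forall v w, adj v w -> sgn [set v; w] = 1 \/ sgn [set v; w] = -1
}.

(* [ucycle] is a closed walk without repeated vertex; the size bound excludes
   the empty sequence and the back-and-forth walk along one edge. *)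
Definition is_cycle (G : signed_graph) (c : seq (vertex G)) : Prop :=
  (2 < size c)%N /\ ucycle (@adj G) c.

Definition negative_edges (G : signed_graph) (c : seq (vertex G)) : nat :=
  count (fun v => sgn [set v; next c v] == -1) c.

Definition balanced (G : signed_graph) : Prop :=
  forall c : seq (vertex G), is_cycle c -> ~~ odd (negative_edges c).

Definition proper_colouring (G : signed_graph) (C : {fset int})
    (k : {ffun vertex G -> C}) : bool :=
  [forall v, forall w, adj v w ==> (val (k v) != sgn [set v; w] * val (k w))].

Definition num_colourings (G : signed_graph) (C : {fset int}) : nat :=
  #|[set k : {ffun vertex G -> C} | proper_colouring k]|.

Definition fset_opp (A : {fset int}) : {fset int} := [fset - x | x in A]%fset.

Definition colour_set (l m : nat) (C : {fset int}) : Prop :=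
  exists P U : {fset int},
    [/\ 0 \notin P, 0 \notin U & [disjoint P & U]%fset] /\
    [/\ fset_opp P = P, #|` U| = m & (fset_opp U `&` U = fset0)%fset] /\
    (~~ odd (l - m) /\ #|` P| = (l - m)%N /\ C = (P `|` U)%fset \/
     odd (l - m) /\ #|` P| = (l - m - 1)%N /\ C = (P `|` U `|` [fset 0])%fset).

(* The common number of proper C-colourings over all (l, m)-colour sets C;
   relevant for m <= l only. *)
Definition fcol (G : signed_graph) (l m : nat) : nat :=
  epsilon (inhabits 0%N)
    (fun n => forall C, colour_set l m C -> num_colourings G C = n).

(* Evaluation at x = a, y = b, where x = 'X_0 and y = 'X_1. *)
Definition eval2 (p : {mpoly int[2]}) (a b : int) : int :=
  p.@[fun i : 'I_2 => if i == ord0 then a else b].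

Definition Epoly (G : signed_graph) : {mpoly int[2]} :=
  epsilon (inhabits (0 : {mpoly int[2]})) (fun p => forall l m : nat,
    (m <= l)%N -> ~~ odd (l - m) -> (fcol G l m)%:Z = eval2 p l%:Z m%:Z).

Definition Opoly (G : signed_graph) : {mpoly int[2]} :=
  epsilon (inhabits (0 : {mpoly int[2]})) (fun p => forall l m : nat,
    (m <= l)%N -> odd (l - m) -> (fcol G l m)%:Z = eval2 p l%:Z m%:Z).

(* Main.v *)
Require Import Defs.
From Stdlib Require Import ClassicalEpsilon.
From mathcomp Require Import all_boot all_order all_algebra.
From mathcomp Require Import finmap.
From mathcomp Require Import mpoly.

(** Inclusion-exclusion over the set [S] of violated edges writes the number of
    proper [C]-colourings as a signed sum of products over the components of
    [(V, S)].  A component contributes [#|C|] if all its vertices get the same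
    colour, [#|C :&: -C|] if it is balanced but forces both [c] and [-c] to
    occur, and [1] or [0] according to whether [0] is a colour if it is
    unbalanced.  This makes [E] and [O] explicit: they differ only in the value
    [0] or [1] of unbalanced components, hence coincide if there are none.

    Conversely, at [y = 0] the difference [O - E] is the sum over the unbalanced
    [S] of [(-1) ^ |S| x ^ b(S)], where [b(S)] is the number of balanced
    components.  If [g] is the length of a shortest negative cycle then
    [b(S) <= n - g]; equality forces [S] to be the edge set of a shortest
    negative cycle, because such a cycle has no chord.  So the coefficient of
    [x ^ (n - g)] is [(-1) ^ g] times the number of negative cycles of length
    [g], which is not [0]. *)

Set Implicit Arguments.
Unset Strict Implicit.
Unset Printing Implicit Defensive.

Import Order.TTheory GRing.Theory Num.Theory.

(** * Signs of walks, shortest negative cycles and the signed double cover *)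

Section SignedWalks.

Variables (V : finType) (sg : rel V).
Hypothesis sgC : ssrbool.symmetric sg.

(** Signs are booleans, [true] for a negative edge, so that the product of signs becomes exclusive
    or. *)
Fixpoint walk_sign (x : V) (p : seq V) : bool :=
  if p is y :: p' then sg x y (+) walk_sign y p' else false.

Definition cycle_sign (c : seq V) : bool :=
  if c is x :: p then walk_sign (last x p) c else false.

(** Vertices may repeat here; simplicity is derived for shortest closed walks only. *)
Definition neg_cycle (e : rel V) (c : seq V) : bool := cycle e c && cycle_sign c.

Definition min_neg_cycle (e : rel V) (c : seq V) : Prop :=
  neg_cycle e c /\ forall d, neg_cycle e d -> size c <= size d.

Lemma walk_sign_cat x p q :
  walk_sign x (p ++ q) = walk_sign x p (+) walk_sign (last x p) q.
Proof. by elim: p x => //= y p IH x; rewrite IH addbA. Qed.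

Lemma cycle_signE x c : cycle_sign c = walk_sign (last x c) c.
Proof. by case: c. Qed.

Lemma cycle_sign_rot n c : cycle_sign (rot n c) = cycle_sign c.
Proof.
case: c => [|x0 c0]; first by rewrite /rot; case: n.
rewrite -{2}(cat_take_drop n (x0 :: c0)) /rot.
case: (take _ _) (drop _ _) => [|x a] [|y b]; rewrite ?cats0 //.
by rewrite !(cycle_signE x) !last_cat !walk_sign_cat /= addbC.
Qed.

Lemma neg_cycle_rot e n c : neg_cycle e (rot n c) = neg_cycle e c.
Proof. by rewrite /neg_cycle rot_cycle cycle_sign_rot. Qed.

Lemma min_neg_cycle_rot e n c : min_neg_cycle e c -> min_neg_cycle e (rot n c).
Proof. by case=> Nc minc; split; rewrite ?neg_cycle_rot ?size_rot. Qed.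

Lemma min_neg_cycle_exists e c : neg_cycle e c -> exists d, min_neg_cycle e d.
Proof.
move=> Nc; pose P m := [exists t : m.-tuple V, neg_cycle e t].
have exP : exists m, P m by exists (size c); apply/existsP; exists (in_tuple c).
case: (ex_minnP exP) => m /existsP[t Nt] minm; exists t; split=> // d Nd.
by rewrite size_tuple; apply: minm; apply/existsP; exists (in_tuple d).
Qed.

(** Links [negative_edges] to walk signs. Vertices must be distinct because [next] looks a vertex up
    at its first occurrence. *)
Lemma negative_count_parity c :
  uniq c -> odd (count (fun v => sg v (next c v)) c) = cycle_sign c.
Proof.
case: c => // x p Uc.
have -> : cycle_sign (x :: p) = walk_sign x (rcons p x).
  by rewrite -(cycle_sign_rot 1) rot1_cons (cycle_signE x) last_rcons.
have Ewalk y q : walk_sign y q = odd (count id (pairmap sg y q)).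
  by elim: q y => //= z q IH y; rewrite IH oddD oddb.
rewrite Ewalk -(count_map (fun v => sg v (next (x :: p) v)) id).
congr (odd (count id _)); apply: (@eq_from_nth _ false).
  by rewrite size_map size_pairmap size_rcons.
move=> i; rewrite size_map => lt_i.
rewrite (nth_map x) // (nth_pairmap x) ?size_rcons //.
rewrite next_nth mem_nth // index_uniq // -rcons_cons nth_rcons lt_i.
congr (sg _ _); rewrite nth_rcons; move: lt_i; rewrite ltnS leq_eqVlt /=.
by case/predU1P => [->|->] //; rewrite ltnn eqxx nth_default.
Qed.

Variable e : rel V.
Hypothesis eC : ssrbool.symmetric e.
Hypothesis e_irr : irreflexive e.

Lemma not_uniq_split (s : seq V) :
  ~~ uniq s -> exists x a b d, s = a ++ x :: b ++ x :: d.
Proof.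
elim: s => //= x s IH; rewrite negb_and negbK.
have [/splitPr[b d] _|_ /IH[y [a [b [d ->]]]]] := boolP (x \in s).
  by exists x, [::], b, d.
by exists y, (x :: a), b, d.
Qed.

(** A repeated vertex cuts the closed walk into two shorter ones whose signs multiply to the sign of
    the whole, so one of them would be negative. *)
Lemma min_neg_cycle_uniq c : min_neg_cycle e c -> uniq c.
Proof.
move=> minc; apply/idPn => /not_uniq_split[x [a [b [d Ec]]]].
have := min_neg_cycle_rot (size a) minc; rewrite Ec rot_size_cat /=.
set r := (d ++ a); rewrite -catA /= -/r => -[/andP[cyc sgn] min].
have := cyc; rewrite /= rcons_cat cat_path /=.
case/and3P=> pb exb pr.
have cb : cycle e (x :: b) by rewrite /= rcons_path pb.
have cr : cycle e (x :: r) by [].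
have : cycle_sign (x :: b) (+) cycle_sign (x :: r).
  move: sgn; rewrite /cycle_sign /= walk_sign_cat /= last_cat /=.
  by case: (sg (last x r) x) (walk_sign x b) (sg (last x b) x) (walk_sign x r)
    => [] [] [] [].
have [sb _|_] := boolP (cycle_sign (x :: b)).
  have := min (x :: b); rewrite /neg_cycle cb sb => /(_ isT).
  by rewrite /= size_cat /= !ltnS -{2}[size b]addn0 leq_add2l.
rewrite addFb => sr.
have := min (x :: r); rewrite /neg_cycle cr sr => /(_ isT).
by rewrite /= size_cat ltnS /= addnS ltnNge leq_addl.
Qed.

(** Length 1 would need a loop; length 2 runs along one edge twice, with positive sign. *)
Lemma neg_cycle_size c : neg_cycle e c -> 2 < size c.
Proof.
case: c => [|x [|y [|z c]]] //=; rewrite /neg_cycle /= ?e_irr //.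
by rewrite (sgC y x) addbF addbb andbF.
Qed.

(* A chord would split the cycle into two shorter ones, one of them negative. *)
Lemma min_neg_cycle_chordless c y z :
  min_neg_cycle e c -> y \in c -> z \in c -> e y z ->
  z = next c y \/ y = next c z.
Proof.
move=> minc yc zc eyz; have Uc := min_neg_cycle_uniq minc.
have [i q Ec] := rot_to yc.
have := min_neg_cycle_rot i minc; rewrite -!(next_rot i Uc).
have : z \in rot i c by rewrite mem_rot.
have : uniq (rot i c) by rewrite rot_uniq.
rewrite Ec inE => Uq /predU1P[Ezy|/splitPr E]; first by rewrite Ezy e_irr in eyz.
case: {q} E Ec Uq => q1 q2 Ec Uq [/andP[cyc sgn] min].
have /and3P[pq1 eq1 pq2] :
  [&& path e y q1, e (last y q1) z & path e z (rcons q2 y)].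
  by move: cyc; rewrite /= rcons_cat cat_path.
have c1 : cycle e (y :: rcons q1 z).
  by rewrite /= !rcons_path last_rcons pq1 eq1 eC.
have c2 : cycle e (y :: z :: q2) by rewrite /= eyz.
have : cycle_sign (y :: rcons q1 z) (+) cycle_sign (y :: z :: q2).
  move: sgn; rewrite /cycle_sign /= walk_sign_cat /= last_cat /= last_rcons -cats1.
  rewrite walk_sign_cat /= (sgC z y).
  by case: (sg y z) (walk_sign y q1) (sg _ z) (sg _ y) (walk_sign z q2)
    => [] [] [] [] [].
have [s1 _|_] := boolP (cycle_sign (y :: rcons q1 z)).
  (* The negative part through [q1] is as long as the whole cycle only if [z] is its last vertex, so
     the chord is the closing edge. *)
  have E2 : q2 = [::].
    have := min (y :: rcons q1 z); rewrite /neg_cycle c1 s1 => /(_ isT).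
    rewrite /= size_cat size_rcons /= ltnS addnS ltnS -{2}[size q1]addn0.
    by rewrite leq_add2l leqn0 size_eq0 => /eqP.
  right; move: Uq; rewrite E2 => Uq.
  rewrite next_nth !inE mem_cat mem_head !orbT /= eq_sym.
  have -> : (z == y) = false.
    by apply/eqP => Ezy; rewrite Ezy e_irr in eyz.
  have zq1: z \notin q1.
    by move: Uq; rewrite cats1 cons_uniq rcons_uniq => /and3P[].
  by rewrite index_cat (negPf zq1) /= eqxx addn0 nth_default // size_cat addn1.
rewrite addFb => s2.
(* In the other case minimality empties [q1], and [z] directly follows [y]. *)
left; have := min (y :: z :: q2); rewrite /neg_cycle c2 s2 => /(_ isT).
rewrite /= size_cat /= !addnS !ltnS -{2}[size q2]add0n leq_add2r leqn0 size_eq0.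
by move=> /eqP->; rewrite /= eqxx.
Qed.

(* Vertex [(x, b)] of the double cover carries the colour [(-1) ^+ b] times the
   colour of [x], so a colouring satisfying all equalities
   [k x = (-1) ^+ sg x y * k y] is constant on its components. *)
Definition cover_rel : rel (V * bool) :=
  fun a b => e a.1 b.1 && (b.2 == a.2 (+) sg a.1 b.1).

Definition linked (x y : V) (t : bool) := connect cover_rel (x, false) (y, t).

(** The two lifts of [x] lie in one component of the cover: some closed walk at [x] is negative. *)
Definition unbalanced_at (x : V) := linked x x true.

Lemma cover_connectP x s y t :
  reflect (exists p, [/\ path e x p, last x p = y & s (+) walk_sign x p = t])
          (connect cover_rel (x, s) (y, t)).
Proof.
apply: (iffP connectP) => [[p]|[p]].
  elim: p x s => [|[z u] p IH] x s /=.
    by move=> _ [-> ->]; exists [::]; rewrite addbF.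
  case/andP=> /andP[/= exz /eqP->] Pp Ep.
  have [q [Pq Lq Sq]] := IH _ _ Pp Ep.
  by exists (z :: q); rewrite /= exz addbA.
elim: p x s => [|z p IH] x s /=.
  by case=> _ -> <-; exists [::]; rewrite ?addbF.
case=> /andP[exz Pp] Lp Sp.
have [|q Pq Eq] := IH z (s (+) sg x z); first by split; rewrite // -addbA.
by exists ((z, s (+) sg x z) :: q); rewrite //= /cover_rel /= exz eqxx.
Qed.

Lemma linkedP x y t :
  reflect (exists p, [/\ path e x p, last x p = y & walk_sign x p = t])
          (linked x y t).
Proof. exact: (cover_connectP x false y t). Qed.

Lemma linked_refl x : linked x x false. Proof. exact: connect0. Qed.

Lemma linked_trans y x z s t :
  linked x y s -> linked y z t -> linked x z (s (+) t).
Proof.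
move=> /linkedP[p [Pp Lp Sp]] /linkedP[q [Pq Lq Sq]]; apply/linkedP.
by exists (p ++ q); rewrite cat_path walk_sign_cat last_cat Lp Pp Pq Lq Sp Sq.
Qed.

Lemma linked_edge x y : e x y -> linked x y (sg x y).
Proof.
by move=> exy; apply/linkedP; exists [:: y]; rewrite /= exy addbF.
Qed.

Lemma linked_sym x y t : linked x y t -> linked y x t.
Proof.
case/linkedP=> p []; elim: p x t => [|z p IH] x t /=.
  by move=> _ -> <-; apply: linked_refl.
case/andP=> exz Pp Lp <-; rewrite addbC.
apply: linked_trans (IH _ _ Pp Lp erefl) _.
by rewrite sgC; apply: linked_edge; rewrite eC.
Qed.

Lemma connect_linked x y : connect e x y -> exists t, linked x y t.
Proof.
by case/connectP=> p Pp ->; exists (walk_sign x p); apply/linkedP; exists p.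
Qed.

Lemma unbalanced_at_connect x y :
  connect e x y -> unbalanced_at x -> unbalanced_at y.
Proof.
move=> /connect_linked[t Lxy] Ux.
have := linked_trans (linked_trans (linked_sym Lxy) Ux) Lxy.
by rewrite addbC addKb.
Qed.

Lemma neg_cycle_unbalanced c x : neg_cycle e c -> x \in c -> unbalanced_at x.
Proof.
move=> Nc /rot_to[i q Ec]; move: Nc; rewrite -(neg_cycle_rot e i) Ec.
case/andP; rewrite (cycle_path x) /= => /andP[elx Pq] Sq.
have Lxl : linked x (last x q) (walk_sign x q) by apply/linkedP; exists q.
by have := linked_trans Lxl (linked_edge elx); rewrite addbC Sq.
Qed.

Lemma unbalanced_neg_cycle x : unbalanced_at x -> exists c, neg_cycle e c.
Proof.
case/linkedP=> p [Pp Lp Sp]; exists p.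
by rewrite /neg_cycle (cycle_path x) (cycle_signE x) Lp Pp.
Qed.

Lemma connect_e_sym : connect_sym e.
Proof. by apply: sym_connect_sym => x y; apply: eC. Qed.

End SignedWalks.

Local Open Scope ring_scope.

(** * Counting the colourings that violate every edge of a given graph *)

Section MonochromaticCount.

Variables (V : finType) (sg e : rel V).
Hypothesis sgC : ssrbool.symmetric sg.
Hypothesis eC : ssrbool.symmetric e.
Variable C : {fset int}.
Implicit Type k : {ffun V -> C}.

(** Constant on components up to the signs of walks: this is violation of properness at every edge
    of [e]. *)
Definition monochromatic k : bool :=
  [forall x, forall y, e x y ==> (val (k x) == (-1) ^+ sg x y * val (k y))].

Definition mixed_at (x : V) : bool := [exists y, linked sg e x y true].

(** The colours at a root that extend to its component: a negative walk to some vertex forces [- c]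
    to be a colour as well, and a negative closed walk forces [c = - c]. *)
Definition root_colours (x : V) : {set C} :=
  [set c : C | (mixed_at x ==> (- val c \in C))
               && (unbalanced_at sg e x ==> (val c == 0))].

Lemma monochromatic_linked k x y t :
  monochromatic k -> linked sg e x y t -> val (k x) = (-1) ^+ t * val (k y).
Proof.
move=> /forallP mk /linkedP[p []]; elim: p x t => [|z p IH] x t /=.
  by move=> _ -> <-; rewrite mul1r.
case/andP=> exz Pp Lp <-; have /forallP/(_ z) := mk x; rewrite exz => /eqP->.
by rewrite (IH z _ Pp Lp erefl) signr_addb mulrA.
Qed.

Lemma int_eq_opp0 (a : int) : (a == - a) = (a == 0).
Proof. by rewrite -addr_eq0 -mulr2n mulrn_eq0. Qed.

Lemma card_root_colours x :
  #|root_colours x| =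
  if unbalanced_at sg e x then (0 \in C : nat)
  else if mixed_at x then #|` [fset c in C | - c \in C]%fset| else #|` C|.
Proof.
case: ifP => [Ux|nUx].
  have Mx : mixed_at x by apply/existsP; exists x.
  have [C0|nC0] := boolP (0 \in C).
    rewrite (_ : root_colours x = [set [` C0]%fset]) ?cards1 //.
    apply/setP => c; rewrite !inE Ux Mx /= -val_eqE /=.
    by apply/andP/eqP => [[_ /eqP]|->] //; rewrite oppr0.
  apply: eq_card0 => c; rewrite !inE Ux; apply/negbTE; rewrite negb_and.
  apply/orP; right; apply: contra nC0 => /eqP <-; exact: valP.
case: ifP => Mx; last first.
  by rewrite cardfE; apply: eq_card => c; rewrite !inE Mx nUx.
rewrite cardE -(size_map val) cardfE cardE -(size_map val).
apply/perm_size/uniq_perm.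
- by rewrite (map_inj_uniq val_inj) enum_uniq.
- by rewrite (map_inj_uniq val_inj) enum_uniq.
move=> a; apply/mapP/mapP => -[c Hc ->].
  move: Hc; rewrite mem_enum !inE Mx nUx /= andbT => Hc.
  have Hin : val c \in [fset c in C | - c \in C]%fset by rewrite !inE (valP c).
  by exists [` Hin]%fset; rewrite ?mem_enum.
have := valP c; rewrite !inE => /andP[cC ncC].
by exists [` cC]%fset; rewrite ?mem_enum // !inE Mx nUx /= ncC.
Qed.

(** The value [None] off the roots makes the image a partial family, counted by [card_pfamily]. *)
Definition root_restriction k : {ffun V -> option C} :=
  [ffun x => if roots e x then Some (k x) else None].

Lemma root_restriction_inj :
  {in [set k | monochromatic k] &, injective root_restriction}.
Proof.
move=> k k'; rewrite !inE => mk mk' /ffunP Ekk'; apply/ffunP => x.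
have [t Lt] := connect_linked sg (connect_root e x).
apply: val_inj; rewrite (monochromatic_linked mk Lt) (monochromatic_linked mk' Lt).
have := Ekk' (fingraph.root e x); rewrite !ffunE roots_root; last exact: connect_e_sym.
by case=> ->.
Qed.

(** Admissible root colours extend by transport along walks. Two walks of different sign to the same
    vertex make its component unbalanced; the root colour is then 0 and the choice of walk is
    immaterial. *)
Lemma root_restriction_image :
  root_restriction @: [set k | monochromatic k] =i
  pfamily None (roots e) (fun x => [set Some c | c in root_colours x]).
Proof.
have Csym := connect_e_sym eC.
move=> f; apply/imsetP/pfamilyP => [[k]|[supp_f famf]].
  rewrite inE => mk ->; split=> [|x Rx].
    by apply/subsetP => x; rewrite !inE ffunE; case: ifP.
  rewrite ffunE (Rx : roots e x); apply: imset_f; rewrite inE; apply/andP; split.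
    apply/implyP => /existsP[y /(monochromatic_linked mk)->].
    by rewrite mulN1r opprK; apply: valP.
  apply/implyP => /(monochromatic_linked mk); rewrite mulN1r => /eqP.
  by rewrite int_eq_opp0.
(* [c] is the colour [a] of the root of [y], transported along some walk of sign [t]. *)
pose P y (c : C) := exists a t,
  [/\ f (fingraph.root e y) = Some a, linked sg e (fingraph.root e y) y t
    & val c = (-1) ^+ t * val a].
have exP y : exists c, P y c.
  have /imsetP[a] := famf _ (roots_root Csym y).
  rewrite inE => /andP[Ma Ua] Ea.
  have [t /(linked_sym sgC eC) Lt] := connect_linked sg (connect_root e y).
  case: t Lt => Lt.
    have Na : - val a \in C by apply: (implyP Ma); apply/existsP; exists y.
    by exists [` Na]%fset, a, true; rewrite mulN1r.
  by exists a, a, false; rewrite mul1r.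
have [k Pk] := fin_all_exists exP.
have U0 y a : f (fingraph.root e y) = Some a ->
    unbalanced_at sg e (fingraph.root e y) -> val a = 0.
  move=> Ea Ur; have /imsetP[a'] := famf _ (roots_root Csym y).
  by rewrite Ea inE => /andP[_ /implyP/(_ Ur)/eqP a0] [->].
exists (finfun k); last first.
  apply/ffunP => y; rewrite !ffunE; case: ifP => [/eqP Ry|nRy].
    have [a [t [Ea Lt Ec]]] := Pk y; move: (U0 y a Ea) Lt.
    rewrite Ry in Ea *; rewrite Ea => Ua Lt; congr Some; apply: val_inj.
    by rewrite Ec; case: t Lt {Ec} => [/Ua->|_]; rewrite ?mulr0 ?mul1r.
  by apply/eqP/idPn => nf; have := subsetP supp_f y nf; rewrite inE nRy.
rewrite inE; apply/forallP => x; apply/forallP => y; apply/implyP => exy.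
rewrite !ffunE.
have [a [t [Ea Lt ->]]] := Pk x; have [b [u [Eb Lu ->]]] := Pk y.
have Er : fingraph.root e y = fingraph.root e x.
  by apply/eqP; rewrite root_connect // connect1 // eC.
move: Eb Lu; rewrite Er Ea => -[<-] Lu.
(* The walks to [x] and [y] and the edge between them form a closed walk at the root. Either its
   sign is positive and the two transports agree, or the root colour is 0. *)
have Lux := linked_trans (linked_trans Lt (linked_edge sg exy)) (linked_sym sgC eC Lu).
apply/eqP; rewrite mulrA -signr_addb.
have [E|nE] := eqVneq (sg x y (+) u) t; first by rewrite E.
rewrite (U0 x a Ea) ?mulr0 // /unbalanced_at.
by move: nE Lux; case: (sg x y) t u {Lt Lu} => [] [] [].
Qed.

Lemma card_monochromatic :
  #|[set k | monochromatic k]| =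
  (\prod_(x in roots e)
     if unbalanced_at sg e x then (0%R \in C : nat)
     else if mixed_at x then #|` [fset c in C | (- c)%R \in C]%fset| else #|` C|)%N.
Proof.
rewrite -(card_in_imset root_restriction_inj) (eq_card root_restriction_image).
rewrite card_pfamily foldrE big_image; apply: eq_bigr => x _.
by rewrite -card_root_colours card_imset // => ? ? [].
Qed.

End MonochromaticCount.

(** * Polynomials in two variables determined by their values on one parity class *)

Section PolynomialIdentity.

Lemma poly_eq0_of_roots (R : idomainType) (f : nat -> R) (p : {poly R}) :
  injective f -> (forall k, p.[f k] = 0) -> p = 0.
Proof.
move=> f_inj p0; apply: (@roots_geq_poly_eq0 _ _ (map f (iota 0 (size p)))).
- by apply/allP => _ /mapP[k _ ->]; apply/rootP.
- by rewrite map_inj_uniq ?iota_uniq.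
- by rewrite size_map size_iota.
Qed.

Let y_idx : 'I_2 := lift ord0 ord0.

(** The outer variable is [y] and the inner one is [x], so that the one-variable root bound can be
    applied twice. *)
Definition bivariate (p : {mpoly int[2]}) : {poly {poly int}} :=
  \sum_(m <- msupp p) (p@_m *: 'X^(m ord0))%:P * 'X^(m y_idx).

Lemma bivariate_eval p a b : (bivariate p).[b%:P].[a] = eval2 p a b.
Proof.
rewrite /eval2 mevalE /bivariate !horner_sum; apply: eq_bigr => m _.
rewrite !hornerE /= big_ord_recl big_ord1 /= -mulrA; congr (_ * (_ * _)).
Qed.

Lemma bivariate_eq0 p : bivariate p = 0 -> p = 0.
Proof.
move=> p0; apply/mpolyP => m; rewrite mcoeff0.
have [mp|/memN_msupp_eq0 //] := boolP (m \in msupp p).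
have : (bivariate p)`_(m y_idx)`_(m ord0) = 0 by rewrite p0 !coef0.
rewrite coef_sum coef_sum (bigD1_seq m) ?msupp_uniq //=.
rewrite coefCM coefXn eqxx mulr1 coefZ coefXn eqxx mulr1 big1 ?addr0 //.
move=> m' nm; rewrite coefCM coefXn.
have [E1|] := eqVneq; last by rewrite mulr0 coef0.
rewrite mulr1 coefZ coefXn; have [E0|] := eqVneq; last by rewrite mulr0.
case/eqP: nm; apply/mnmP => i; case: (unliftP ord0 i) => [j ->|-> //].
by rewrite ord1.
Qed.

(** This is the uniqueness of [E] and of [O]. For each fixed [y = m] the admissible
    [x = m + b + 2 k] are infinitely many, and so are the values [m]. *)
Lemma eval2_inj_parity (b : bool) (p q : {mpoly int[2]}) :
  (forall l m : nat, (m <= l)%N -> odd (l - m) = b ->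
     eval2 p l%:Z m%:Z = eval2 q l%:Z m%:Z) -> p = q.
Proof.
move=> Epq; apply/eqP; rewrite -subr_eq0; apply/eqP/bivariate_eq0.
apply: (@poly_eq0_of_roots _ (fun m : nat => (m%:Z)%:P)).
  by move=> m m' /polyC_inj [].
move=> m; apply: (@poly_eq0_of_roots _ (fun k : nat => (m + (b + k.*2))%N%:Z)).
  by move=> k k' [] /addnI/addnI/double_inj.
move=> k; rewrite bivariate_eval /eval2 mevalB; apply/eqP; rewrite subr_eq0.
apply/eqP/Epq; rewrite ?leq_addr // addKn oddD odd_double addbF.
by case: b {Epq}.
Qed.

End PolynomialIdentity.

(** * Colour sets: their cardinalities and their existence *)

Section ColourSets.

Lemma mem_fset_opp (A : {fset int}) a : (a \in fset_opp A) = (- a \in A).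
Proof.
apply/imfsetP/idP => [[b /= bA ->]|aA]; first by rewrite opprK.
by exists (- a); rewrite ?opprK.
Qed.

(** The colours whose negatives are colours are those of [P], together with 0 in the odd case. These
    three data determine all the counts of monochromatic colourings, whence independence of [C]. *)
Lemma colour_set_card l m C : (m <= l)%N -> colour_set l m C ->
  [/\ #|` C| = l, #|` [fset c in C | - c \in C]%fset| = (l - m)%N
    & (0 \in C) = odd (l - m)].
Proof.
move=> le_ml [P [U [[P0 U0 PU] [[PN Um UN] PC]]]].
have opP a : (- a \in P) = (a \in P) by rewrite -mem_fset_opp PN.
have opU a : a \in U -> (- a \in U) = false.
  move=> aU; apply/negP => naU; have : a \in (fset_opp U `&` U)%fset.
    by rewrite inE mem_fset_opp naU.
  by rewrite UN inE.
have dPU a : a \in P -> (a \in U) = false.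
  by move=> aP; apply/negP => aU; have /fdisjointP/(_ a aP) := PU; rewrite aU.
have cPU : #|` (P `|` U)%fset| = (#|` P| + m)%N.
  by rewrite cardfsU (eqP PU) cardfs0 subn0 Um.
case: PC => -[Olm [cP ->]].
  have -> : [fset c in (P `|` U) | - c \in (P `|` U)]%fset = P.
    apply/fsetP => a; rewrite !inE opP.
    have [aP|naP] //= := boolP (a \in P).
    by have [/opU|] := boolP (a \in U).
  by rewrite cPU cP subnK // !inE (negPf P0) (negPf U0) (negPf Olm).
have n0 : 0 \notin (P `|` U)%fset by rewrite inE negb_or P0.
have -> : [fset c in (P `|` U `|` [fset 0]) | - c \in (P `|` U `|` [fset 0])]%fset
          = (0 |` P)%fset.
  apply/fsetP => a; rewrite !inE opP oppr_eq0 orbC.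
  have [->|_] /= := eqVneq a 0; first by rewrite ?orbT.
  have [aP|naP] //= := boolP (a \in P).
  by have [/opU ->|] := boolP (a \in U).
have lm0 : (0 < l - m)%N by case: (l - m)%N Olm.
rewrite fsetUC !cardfsU1 n0 P0 cPU cP !inE eqxx Olm /=; split=> //.
  by rewrite addnA subnKC // subnK.
by rewrite subnKC.
Qed.

Lemma colour_set_exists l m : (m <= l)%N -> exists C, colour_set l m C.
Proof.
move=> le_ml; pose k := (l - m)./2.
(* [P] consists of the integers of absolute value 1 to [k], and [U] of the integers from [k + 1] to
   [k + m]. *)
pose A := [fset i.+1%:Z | i in iota 0 k]%fset.
pose P := (A `|` fset_opp A)%fset.
pose U := [fset (k + i).+1%:Z | i in iota 0 m]%fset.
have inA a : reflect (exists2 i, (i < k)%N & a = i.+1%:Z) (a \in A).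
  by apply: (iffP (imfsetP _ _ _ _)) => -[i /= ik ->]; exists i => //;
    rewrite mem_iota in ik *.
have inU a : reflect (exists2 i, (i < m)%N & a = (k + i).+1%:Z) (a \in U).
  by apply: (iffP (imfsetP _ _ _ _)) => -[i /= ik ->]; exists i => //;
    rewrite mem_iota in ik *.
have cA : #|` A| = k by rewrite card_imfset /= ?undup_id ?iota_uniq ?size_iota // => i j [].
have cU : #|` U| = m by rewrite card_imfset /= ?undup_id ?iota_uniq ?size_iota // => i j [] /addnI.
have cP : #|` P| = k.*2.
  have -> : #|` P| = (#|` A| + #|` fset_opp A|)%N.
    rewrite cardfsU (_ : (A `&` _)%fset = fset0) ?cardfs0 ?subn0 //.
    apply/fsetP => a; rewrite !inE mem_fset_opp; apply/negP.
    by case/andP=> /inA[i _ ->] /inA[].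
  by rewrite (card_imfset _ _ (@oppr_inj _)) /= !cA addnn.
have hyps : [/\ 0 \notin P, 0 \notin U & [disjoint P & U]%fset] /\
    [/\ fset_opp P = P, #|` U| = m & (fset_opp U `&` U = fset0)%fset].
  split; split=> //.
  - by rewrite inE mem_fset_opp oppr0 orbb; apply/inA => -[].
  - by apply/inU => -[].
  - apply/fdisjointP => a; rewrite inE mem_fset_opp => /orP[]/inA[i ik Ea].
      apply/inU => -[j jm]; rewrite Ea => -[] Ei.
      by rewrite Ei ltnNge leq_addr in ik.
    by apply/inU => -[j jm] Ea'; rewrite Ea' in Ea.
  - by apply/fsetP => a; rewrite mem_fset_opp !inE !mem_fset_opp opprK orbC.
  - apply/fsetP => a; rewrite !inE mem_fset_opp; apply/negP.
    by case/andP=> /inU[i _ Ea] /inU[j _ Ea']; rewrite Ea' in Ea.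
have [hyp1 hyp2] := hyps; have Elm := odd_double_half (l - m).
case: (boolP (odd (l - m))) Elm => Olm; rewrite -/k => Elm.
  exists (P `|` U `|` [fset 0])%fset, P, U; do 2!split=> //; right.
  by split=> //; rewrite cP -Elm addKn.
exists (P `|` U)%fset, P, U; do 2!split=> //; left.
by split=> //; rewrite cP -Elm.
Qed.

End ColourSets.

(** * Inclusion-exclusion over violated edges and explicit formulas for both polynomials *)

Section ChromaticPolynomials.

Variable G : signed_graph.
Local Notation V := (vertex G).
Implicit Types S : {set {set V}}.

Definition neg_edge : rel V := fun v w => sgn [set v; w] == -1.

Definition edges : {set {set V}} :=
  [set f | [exists v, exists w, adj v w && (f == [set v; w])]].

Definition edge_rel S : rel V := fun v w => adj v w && ([set v; w] \in S).

Lemma neg_edge_sym : ssrbool.symmetric neg_edge.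
Proof. by move=> v w; rewrite /neg_edge setUC. Qed.

Lemma edge_rel_sym S : ssrbool.symmetric (edge_rel S).
Proof. by move=> v w; rewrite /edge_rel setUC adj_sym. Qed.

Lemma edge_rel_irr S : irreflexive (edge_rel S).
Proof. by move=> v; rewrite /edge_rel adj_irr. Qed.

Lemma mem_edges v w : adj v w -> [set v; w] \in edges.
Proof.
by move=> vw; rewrite inE; apply/existsP; exists v; apply/existsP; exists w;
  rewrite vw eqxx.
Qed.

Lemma edgesP (f : {set V}) :
  reflect (exists v w, adj v w /\ f = [set v; w]) (f \in edges).
Proof.
rewrite inE; apply: (iffP existsP) => [[v /existsP[w /andP[vw /eqP->]]]|].
  by exists v, w.
by case=> v [w [vw ->]]; exists v; apply/existsP; exists w; rewrite vw eqxx.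
Qed.

Lemma sgnE v w : adj v w -> sgn [set v; w] = (-1) ^+ neg_edge v w.
Proof. by rewrite /neg_edge => /sgnP[]->. Qed.

Definition violated (C : {fset int}) (k : {ffun V -> C}) (f : {set V}) : bool :=
  [exists v, exists w,
     [&& adj v w, f == [set v; w] & val (k v) == sgn f * val (k w)]].

(** The orientation of the edge does not matter, as its sign squares to 1. *)
Lemma violatedE (C : {fset int}) (k : {ffun V -> C}) v w : adj v w ->
  violated k [set v; w] = (val (k v) == (-1) ^+ neg_edge v w * val (k w)).
Proof.
move=> vw; apply/existsP/idP => [[x /existsP[y /and3P[xy]]]|E]; last first.
  by exists v; apply/existsP; exists w; rewrite vw eqxx (sgnE vw).
move=> /eqP Exy; rewrite (sgnE vw).
have : x \in [set v; w] by rewrite Exy !inE eqxx.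
have : y \in [set v; w] by rewrite Exy !inE eqxx orbT.
rewrite !inE => /orP[]/eqP Ey /orP[]/eqP Ex; rewrite Ex Ey ?adj_irr // in xy *.
by move/eqP=> ->; rewrite mulrA -signr_addb addbb mul1r.
Qed.

Lemma properE (C : {fset int}) (k : {ffun V -> C}) :
  proper_colouring k = [forall f, ~~ violated k f].
Proof.
apply/forallP/forallP => [Pk f|Nk v].
  apply/negP => /existsP[v /existsP[w /and3P[vw /eqP-> E]]].
  by have /forallP/(_ w) := Pk v; rewrite vw E.
apply/forallP => w; apply/implyP => vw.
by have := Nk [set v; w]; rewrite violatedE // (sgnE vw).
Qed.

Lemma monochromaticE (C : {fset int}) (k : {ffun V -> C}) S : S \subset edges ->
  monochromatic neg_edge (edge_rel S) k = [forall f in S, violated k f].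
Proof.
move=> SE; apply/forallP/forall_inP => [Mk f fS|Vk v].
  have /edgesP[v [w [vw Ef]]] := subsetP SE f fS.
  by have /forallP/(_ w) := Mk v; rewrite Ef violatedE // /edge_rel vw -Ef fS.
apply/forallP => w; apply/implyP => /andP[vw /Vk].
by rewrite violatedE.
Qed.

Lemma num_colourings_sum (C : {fset int}) :
  (num_colourings G C)%:Z =
  \sum_(S : {set {set V}} | S \subset edges) (-1) ^+ #|S| *
    (#|[set k : {ffun V -> C} | monochromatic neg_edge (edge_rel S) k]|)%:Z.
Proof.
have card_sum (P : pred {ffun V -> C}) :
    (#|[set k | P k]|)%:Z = \sum_k (P k)%:R.
  rewrite -sum1_card -natz natr_sum [LHS]big_mkcond; apply: eq_bigr => k _.
  by rewrite inE; case: (P k).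
rewrite /num_colourings card_sum.
under [RHS]eq_bigr => S _ do rewrite card_sum mulr_sumr.
rewrite exchange_big; apply: eq_bigr => k _ /=.
have prod_bool (I : finType) (A : pred I) (P : pred I) :
    \prod_(i in A) (P i)%:R = [forall i in A, P i]%:R :> int.
  have [/forall_inP AP|] := boolP [forall i in A, P i].
    by apply: big1 => i /AP->.
  rewrite negb_forall_in => /exists_inP[i Ai nPi].
  by rewrite (bigD1 i) //= (negPf nPi) mul0r.
(* Properness is the product of [1 + F f] over all vertex sets; a set that is not an edge
   contributes the factor 1. *)
pose F f : int := - ((f \in edges) && violated k f)%:R.
transitivity (\prod_(f : {set V}) (F f + 1)).
  rewrite properE.
  transitivity (\prod_(f in {set V}) (~~ violated k f)%:R : int).
    by rewrite prod_bool; congr (nat_of_bool _)%:R.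
  apply: eq_bigr => f _; rewrite /F.
  have [/existsP[v /existsP[w /and3P[vw /eqP-> _]]]|] := boolP (violated k f).
    by rewrite mem_edges // addNr.
  by rewrite andbF oppr0 add0r.
rewrite (@bigA_distr _ _ _ _ _ _ F (fun=> 1)) (bigID (fun S : {set _} => S \subset edges)) /=.
(* After expansion, an index set containing a non-edge has a zero factor. *)
rewrite [X in _ + X]big1 ?addr0 => [|S /subsetPn[f fS /negPf nfE]]; last first.
  by rewrite (bigD1 f) //= fS /F nfE oppr0 mul0r.
apply: eq_bigr => S SE; rewrite monochromaticE // -big_mkcond /=.
rewrite /F prodrN -prod_bool; congr (_ * _).
by apply: eq_bigr => f /(subsetP SE)->.
Qed.

(** [d] tells whether 0 is a colour: 0 yields [E] and 1 yields [O]. The factor [x - y] counts the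
    colours whose negatives are colours. *)
Definition chromatic_mpoly (d : int) : {mpoly int[2]} :=
  \sum_(S : {set {set V}} | S \subset edges) (-1) ^+ #|S| *
    \prod_(x in roots (edge_rel S))
      if unbalanced_at neg_edge (edge_rel S) x then d%:MP
      else if mixed_at neg_edge (edge_rel S) x then 'X_ord0 - 'X_(lift ord0 ord0)
      else 'X_ord0.

Lemma eval2_chromatic_mpoly d a b :
  eval2 (chromatic_mpoly d) a b =
  \sum_(S : {set {set V}} | S \subset edges) (-1) ^+ #|S| *
    \prod_(x in roots (edge_rel S))
      if unbalanced_at neg_edge (edge_rel S) x then d
      else if mixed_at neg_edge (edge_rel S) x then a - b else a.
Proof.
rewrite /eval2 rmorph_sum; apply: eq_bigr => S _.
rewrite rmorphM rmorphXn rmorphN1 rmorph_prod /=; congr (_ * _).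
by apply: eq_bigr => x _; do 2?case: ifP => _; rewrite ?mevalC ?mevalB ?mevalXU.
Qed.

Lemma num_colourings_eval l m C : (m <= l)%N -> colour_set l m C ->
  (num_colourings G C)%:Z =
  eval2 (chromatic_mpoly (odd (l - m))%:Z) l%:Z m%:Z.
Proof.
move=> le_ml /(colour_set_card le_ml)[cC cP C0].
rewrite num_colourings_sum eval2_chromatic_mpoly; apply: eq_bigr => S _.
congr (_ * _).
rewrite card_monochromatic ?cC ?cP ?C0; [|exact: neg_edge_sym|exact: edge_rel_sym].
rewrite -natz natr_prod; apply: eq_bigr => x _.
by do 2?case: ifP => _; rewrite natz // subzn.
Qed.

(** The count is the same for all colour sets, so the choice defining [fcol] is satisfiable; since a
    colour set exists, it fixes the value. *)
Lemma fcolE l m : (m <= l)%N ->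
  (fcol G l m)%:Z = eval2 (chromatic_mpoly (odd (l - m))%:Z) l%:Z m%:Z.
Proof.
move=> le_ml; have [C CS] := colour_set_exists le_ml.
rewrite -(num_colourings_eval le_ml CS); congr Posz; apply/esym.
pose P n := forall D, colour_set l m D -> num_colourings G D = n.
move: C CS; apply: (epsilon_spec (inhabits 0%N) P).
have [C CS] := colour_set_exists le_ml.
exists (num_colourings G C) => D DS.
have := num_colourings_eval le_ml DS.
by rewrite -(num_colourings_eval le_ml CS) => -[].
Qed.

(** The explicit polynomial witnesses existence in the choice, and values on the even class give
    uniqueness. *)
Lemma EpolyE : Epoly G = chromatic_mpoly 0.
Proof.
have spec0 l m : (m <= l)%N -> ~~ odd (l - m) ->
    (fcol G l m)%:Z = eval2 (chromatic_mpoly 0) l%:Z m%:Z.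
  by move=> le_ml /negPf O; rewrite fcolE // O.
apply: (@eval2_inj_parity false) => l m le_ml /negbT O.
rewrite -spec0 //; apply/esym; move: l m le_ml O.
pose P p := forall l m : nat, (m <= l)%N -> ~~ odd (l - m) ->
  (fcol G l m)%:Z = eval2 p l%:Z m%:Z.
by apply: (epsilon_spec _ P); exists (chromatic_mpoly 0).
Qed.

Lemma OpolyE : Opoly G = chromatic_mpoly 1.
Proof.
have spec1 l m : (m <= l)%N -> odd (l - m) ->
    (fcol G l m)%:Z = eval2 (chromatic_mpoly 1) l%:Z m%:Z.
  by move=> le_ml O; rewrite fcolE // O.
apply: (@eval2_inj_parity true) => l m le_ml O.
rewrite -spec1 //; apply/esym; move: l m le_ml O.
pose P p := forall l m : nat, (m <= l)%N -> odd (l - m) ->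
  (fcol G l m)%:Z = eval2 p l%:Z m%:Z.
by apply: (epsilon_spec _ P); exists (chromatic_mpoly 1).
Qed.

End ChromaticPolynomials.

(** * Balance, and the difference of the two polynomials at [y = 0] *)

Section Balance.

Variable G : signed_graph.
Local Notation V := (vertex G).
Local Notation sg := (@neg_edge G).
Implicit Types (S : {set {set V}}) (c : seq V).

Let sgC := @neg_edge_sym G.

Lemma edge_rel_neg_cycle S c :
  neg_cycle sg (edge_rel S) c -> neg_cycle sg (@adj G) c.
Proof.
by case/andP=> cyc ?; apply/andP; split=> //; apply: sub_cycle cyc => v w /andP[].
Qed.

(** Negative closed walks may replace negative cycles, since a shortest one is simple and has at
    least three vertices. *)
Lemma balancedP : balanced G <-> forall c, ~~ neg_cycle sg (@adj G) c.
Proof.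
split=> [bal c|nc c [_ /andP[cyc Uc]]]; last first.
  by have := nc c; rewrite /neg_cycle cyc /= -(negative_count_parity sg Uc).
apply/negP => /min_neg_cycle_exists[d mind].
have Ud := min_neg_cycle_uniq mind; have [Nd _] := mind.
have /andP[cyc sgn] := Nd.
have /bal : is_cycle d.
  by split; [exact: (neg_cycle_size sgC (@adj_irr G) Nd) | rewrite /ucycle cyc].
by rewrite -(negative_count_parity sg Ud) in sgn; rewrite [odd _]sgn.
Qed.

Definition has_unbalanced S : bool := [exists x, unbalanced_at sg (edge_rel S) x].

Definition balanced_roots S : {set V} :=
  [set x in roots (edge_rel S) | ~~ unbalanced_at sg (edge_rel S) x].

Lemma balanced_chromatic_mpoly :
  balanced G -> chromatic_mpoly G 0 = chromatic_mpoly G 1.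
Proof.
move/balancedP=> bal; apply: eq_bigr => S _; congr (_ * _).
apply: eq_bigr => x _; case: ifP => // /unbalanced_neg_cycle[c /edge_rel_neg_cycle].
by rewrite (negPf (bal c)).
Qed.

Definition gap_poly : {poly int} :=
  \sum_(S : {set {set V}} | (S \subset edges G) && has_unbalanced S)
    (-1) ^+ #|S| *: 'X^#|balanced_roots S|.

(** At [y = 0] mixed and unmixed balanced components both contribute [a]. Terms without an
    unbalanced component cancel; in the others the product for [d = 0] vanishes. *)
Lemma gap_polyE (a : int) :
  gap_poly.[a] =
  eval2 (chromatic_mpoly G 1) a 0 - eval2 (chromatic_mpoly G 0) a 0.
Proof.
rewrite !eval2_chromatic_mpoly -sumrB horner_sum big_mkcondr /=.
apply: eq_bigr => S _; rewrite -mulrBr subr0.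
under eq_bigr do rewrite if_same.
under [X in _ - X]eq_bigr do rewrite if_same.
have -> : \prod_(x in roots (edge_rel S))
    (if unbalanced_at sg (edge_rel S) x then 1 else a) = a ^+ #|balanced_roots S|.
  rewrite -prodr_const [RHS](eq_bigl (fun x => (x \in roots (edge_rel S))
    && ~~ unbalanced_at sg (edge_rel S) x)); last by move=> x; rewrite inE.
  by rewrite big_mkcondr; apply: eq_bigr => x _; case: ifP.
case: ifP => [/existsP[x Ux]|/negbT nU].
  rewrite (bigD1 (fingraph.root (edge_rel S) x)) /=; last first.
    by apply/roots_root/connect_e_sym/edge_rel_sym.
  rewrite (unbalanced_at_connect sgC (@edge_rel_sym G S) (connect_root _ x)) //.
  by rewrite mul0r subr0 hornerZ hornerXn.
rewrite [X in _ - X](_ : _ = a ^+ #|balanced_roots S|) ?subrr ?mulr0 //.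
rewrite -prodr_const [RHS](eq_bigl (mem (roots (edge_rel S)))).
  apply: eq_bigr => x _; case: ifP => // Ux.
  by case/existsP: nU; exists x.
move=> x; rewrite inE; have [Ux|] := boolP (unbalanced_at _ _ _).
  by case/existsP: nU; exists x.
by rewrite andbT.
Qed.

Definition cycle_edges c : {set {set V}} := [set [set v; next c v] | v in c].

Lemma card_cycle_edges c : uniq c -> (2 < size c)%N -> #|cycle_edges c| = size c.
Proof.
move=> Uc sz; rewrite card_in_imset; first exact/card_uniqP.
move=> v w vc wc E.
have : v \in [set w; next c w] by rewrite -E !inE eqxx.
have : next c v \in [set w; next c w] by rewrite -E !inE eqxx orbT.
rewrite !inE => + /orP[/eqP //|/eqP Ev].
have nE x y : next c x = next c y -> x = y.
  by move=> /(congr1 (prev c)); rewrite !prev_next.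
case/orP=> /eqP E2; last exact: nE.
(* In the remaining case [v] and [w] succeed each other, which is impossible on three or more
   distinct vertices. *)
have := vc => /rot_to[i q Eq].
have Uq : uniq (rot i c) by rewrite rot_uniq.
have Enn : next (rot i c) (next (rot i c) v) = v by rewrite !next_rot // E2 -Ev.
have sq : (2 < size (rot i c))%N by rewrite size_rot.
move: sq Uq Enn; rewrite Eq; case: q {Eq} => [|y [|z q]] //= _.
rewrite !inE !negb_or eqxx => /and3P[/and3P[nvy nvz _] /andP[nyz _] _].
by rewrite eq_sym (negPf nvy) eqxx => Ezv; rewrite Ezv eqxx in nvz.
Qed.

(** * The extremal coefficient given by the shortest negative cycles *)

Section MinimalNegativeCycle.

Variable c0 : seq V.
Hypothesis min_c0 : min_neg_cycle sg (@adj G) c0.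

(** Take a shortest negative closed walk inside [S]: it is simple, and being negative in [G] it is
    no shorter than [c0]. *)
Lemma has_unbalanced_neg_cycle S : has_unbalanced S ->
  exists c, [/\ neg_cycle sg (edge_rel S) c, uniq c & (size c0 <= size c)%N].
Proof.
case/existsP=> x /unbalanced_neg_cycle[d /min_neg_cycle_exists[c minc]].
exists c; have [Nc _] := minc; have [_ min0] := min_c0.
by rewrite Nc (min_neg_cycle_uniq minc) min0 ?(edge_rel_neg_cycle Nc).
Qed.

Lemma balanced_roots_neg_cycle S c :
  neg_cycle sg (edge_rel S) c -> balanced_roots S \subset ~: [set x in c].
Proof.
move=> Nc; apply/subsetP => x; rewrite !inE => /andP[_]; apply: contra.
exact: neg_cycle_unbalanced Nc.
Qed.

Lemma card_not_cycle c : uniq c -> #|~: [set x in c]| = (#|V| - size c)%N.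
Proof. by move=> Uc; rewrite cardsCs setCK cardsE (card_uniqP Uc). Qed.

Lemma card_balanced_roots_le S :
  has_unbalanced S -> (#|balanced_roots S| <= #|V| - size c0)%N.
Proof.
case/has_unbalanced_neg_cycle=> c [Nc Uc le_c].
apply: leq_trans (subset_leq_card (balanced_roots_neg_cycle Nc)) _.
by rewrite card_not_cycle // leq_sub2l.
Qed.

(* All vertices off the negative cycle are balanced roots, hence isolated in
   [S], so [S] lives on a shortest negative cycle, which has no chord. *)
Lemma extremal_card S :
  S \subset edges G -> has_unbalanced S ->
  #|balanced_roots S| = (#|V| - size c0)%N -> #|S| = size c0.
Proof.
move=> SE /has_unbalanced_neg_cycle[c [Nc Uc le_c]] Eb.
have le_cV : (size c <= #|V|)%N by rewrite -(card_uniqP Uc) max_card.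
have [NcG min0] := (edge_rel_neg_cycle Nc, min_c0.2).
have sz : size c = size c0.
  apply/eqP; rewrite eqn_leq le_c andbT.
  have := subset_leq_card (balanced_roots_neg_cycle Nc).
  rewrite card_not_cycle // Eb => le_b.
  by rewrite -(leq_sub2lE _ le_cV).
have minc : min_neg_cycle sg (@adj G) c by split=> // d /min0; rewrite sz.
have Eroots : balanced_roots S = ~: [set x in c].
  apply/eqP; rewrite eqEcard balanced_roots_neg_cycle // Eb card_not_cycle //.
  by rewrite sz leqnn.
have Csym := connect_e_sym (@edge_rel_sym G S).
(* A vertex [y] off [c] is a balanced root. A neighbour on [c] would make it unbalanced; a neighbour
   off [c] would be a second root of the same component. *)
have off y z : edge_rel S y z -> y \in c.
  move=> yz; apply/idPn => nyc.
  have : y \in balanced_roots S by rewrite Eroots !inE.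
  rewrite inE => /andP[/eqP Ry nUy].
  have [zc|nzc] := boolP (z \in c).
    case/negP: nUy; apply: unbalanced_at_connect (neg_cycle_unbalanced Nc zc) => //.
      exact: edge_rel_sym.
    by rewrite connect1 // edge_rel_sym.
  have : z \in balanced_roots S by rewrite Eroots !inE.
  rewrite inE => /andP[/eqP Rz _].
  have : fingraph.root (edge_rel S) y == fingraph.root (edge_rel S) z.
    by rewrite root_connect // connect1.
  by rewrite Ry Rz => /eqP Eyz; rewrite Eyz edge_rel_irr in yz.
rewrite -sz -card_cycle_edges //; last exact: (neg_cycle_size sgC (@adj_irr G) NcG).
congr #|pred_of_set _|; apply/setP => f; apply/idP/imsetP => [fS|[v vc ->]].
  have /edgesP[y [z [yz Ef]]] := subsetP SE f fS.
  have Syz : edge_rel S y z by rewrite /edge_rel yz -Ef.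
  have yc := off _ _ Syz; have zc : z \in c by apply: (off z y); rewrite edge_rel_sym.
  have [En|En] := min_neg_cycle_chordless sgC (@adj_sym G) (@adj_irr G) minc yc zc yz.
    by exists y; rewrite // Ef En.
  by exists z; rewrite // Ef En setUC.
by have /andP[cyc _] := Nc; have /andP[] := next_cycle cyc vc.
Qed.

(** Vertices off [c0] are isolated in this edge set, so each is a balanced root. *)
Lemma cycle_edges_extremal :
  let S := cycle_edges c0 in
  [/\ S \subset edges G, has_unbalanced S
    & #|balanced_roots S| = (#|V| - size c0)%N].
Proof.
have [N0 _] := min_c0; have /andP[cyc sgn] := N0; have U0 := min_neg_cycle_uniq min_c0.
have sz := neg_cycle_size sgC (@adj_irr G) N0.
pose S := cycle_edges c0; rewrite /= -/S.
have SE : S \subset edges G.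
  by apply/subsetP => f /imsetP[v vc ->]; apply/mem_edges/next_cycle.
have NS : neg_cycle sg (edge_rel S) c0.
  apply/andP; split=> //; apply: cycle_from_next => // v vc.
  by rewrite /edge_rel next_cycle //=; apply: imset_f.
have US : has_unbalanced S.
  case: c0 sz NS => // x p _ NS; apply/existsP; exists x.
  by apply: neg_cycle_unbalanced NS _; rewrite ?mem_head.
split=> //; apply/eqP; rewrite eqn_leq card_balanced_roots_le //=.
rewrite -card_not_cycle //; apply/subset_leq_card/subsetP => x; rewrite !inE => nx.
have isol y : edge_rel S x y = false.
  apply/negP => /andP[_ /imsetP[v vc E]].
  have : x \in [set v; next c0 v] by rewrite -E !inE eqxx.
  by rewrite !inE => /orP[]/eqP Ex; rewrite Ex ?mem_next vc in nx.
apply/andP; split.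
  have /connectP[[|y p] /=] := connect_root (edge_rel S) x.
    by move=> _ E; apply/eqP.
  by rewrite isol.
by apply/linkedP => -[[|y p]] [] //=; rewrite isol.
Qed.

(** No cancellation occurs in the coefficient of degree [#|V| - size c0]: all contributing sets have
    [size c0] elements, hence equal signs, and the edges of [c0] give one of them. *)
Lemma gap_poly_neq0 : gap_poly != 0.
Proof.
apply/eqP => /(congr1 (fun p : {poly int} => p`_(#|V| - size c0))).
rewrite coef0 coef_sum; apply/eqP.
have -> : \sum_(S : {set {set V}} | (S \subset edges G) && has_unbalanced S)
    ((-1) ^+ #|S| *: 'X^#|balanced_roots S| : {poly int})`_(#|V| - size c0) =
  (-1) ^+ size c0 *
  #|[set S : {set {set V}} | [&& S \subset edges G, has_unbalanced S
       & #|balanced_roots S| == #|V| - size c0]%N]|%:R.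
  rewrite -sum1_card natr_sum mulr_sumr.
  rewrite [RHS](eq_bigl (fun S => ((S \subset edges G) && has_unbalanced S)
    && (#|balanced_roots S| == #|V| - size c0)%N)); last first.
    by move=> S; rewrite inE andbA.
  rewrite [RHS]big_mkcondr; apply: eq_bigr => S /andP[SE US].
  rewrite coefZ coefXn eq_sym; case: ifP => [/eqP Eb|_]; last by rewrite mulr0.
  by rewrite (extremal_card SE US Eb).
rewrite mulf_neq0 ?signr_eq0 // pnatr_eq0 -lt0n card_gt0; apply/set0Pn.
exists (cycle_edges c0); have [SE US Eb] := cycle_edges_extremal.
by rewrite inE SE US Eb eqxx.
Qed.

End MinimalNegativeCycle.

End Balance.

Theorem theorem4p8 (G : signed_graph) :
  Epoly G = Opoly G <-> balanced G.
Proof.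
rewrite EpolyE OpolyE; split=> [E|]; last exact: balanced_chromatic_mpoly.
apply/balancedP => c; apply/negP => /min_neg_cycle_exists[d mind].
(* If the two polynomials agree, [gap_poly] vanishes at every natural number, although a negative
   cycle makes it nonzero. *)
case/eqP: (gap_poly_neq0 mind).
apply: (@poly_eq0_of_roots _ (fun k : nat => k%:Z)) => [i j []//|k].
by rewrite gap_polyE E subrr.
Qed.
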